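(* Let $\alpha>0$ and $r\in(0,1]$, let $\phi:[0,1]\to(0,\infty)$ be a nondecreasing function, and let $w,J_F,R\in L^1(\mathbb{R};\mathbb{R}^+)$ be positive definite kernels, each of which is an even function with integral over $\mathbb{R}$ equal to $1$. Let $\bar G\in(0,1)$ be a point at which $\phi$ is differentiable and which is a homogeneous equilibrium of the grass–forest model, i.e. $$\phi(\bar G)-\alpha\bar G\left(1-\frac{1-\bar G}{r}\right)=0 .$$ Set $$A=\phi'(\bar G)(1-\bar G),\quad B=-\frac{\alpha}{r}\bar G(1-\bar G),\quad C=\alpha\bar G\left(1-\frac{1-\bar G}{r}\right),\quad D=-\alpha(1-\bar G)\left(1-\frac{1-\bar G}{r}\right)-\phi(\bar G),$$ and let $$\lambda_\xi=A\,\hat w(|\xi|)+B\,\hat R(|\xi|)+C\,\hat J_F(|\xi|)+D,\qquad \xi\in\mathbb{R},$$ be the dispersion relation of $\bar G$. Assume $\lambda_0=A+B+C+D<0$, i.e. $\bar G$ is stable for the nonspatial model. Then: (1) $\lambda_\xi<0$ for all sufficiently large $|\xi|$; (2) if there exists $\xi\neq0$ with $\lambda_\xi>0$, then $N:=A+C+D>0$.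
   Context: $\hat K(\xi)=\int_{\mathbb{R}}K(x)e^{i\xi x}\,dx$ denotes the Fourier transform. A function $f:\mathbb{R}\to\mathbb{C}$ is positive definite if for all $n$ and all real numbers $x_1,\dots,x_n$ the $n\times n$ matrix with entries $f(x_i-x_j)$ is positive semi-definite. The spatially extended grass–forest model with resource limitation is $$\partial_t G=(1-G)\,\phi(w*G)-\alpha G\,(1-J_F*G)\left(1-\frac1r+\frac1r R*G\right),\qquad (x,t)\in\mathbb{R}\times\mathbb{R}_+,$$ where $(K*u)(x,t)=\int_{\mathbb{R}}K(x-y)u(y,t)\,dy$, and $\lambda_\xi$ is the growth rate of the perturbation with wave number $\xi$ in its linearization about the constant state $\bar G$. The nonspatial model is $\dot G=\phi(G)(1-G)-\alpha G(1-G)\left(1-\frac{1-G}{r}\right)$. *)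

(* Defs.v *)
From HB Require Import structures.
From mathcomp Require Import all_boot all_order all_algebra.
From mathcomp Require Import complex.
From mathcomp Require Import all_classical all_reals all_analysis.

Set Implicit Arguments.
Unset Strict Implicit.
Unset Printing Implicit Defensive.

Import Order.TTheory GRing.Theory Num.Theory.
Import numFieldNormedType.Exports.

Local Open Scope classical_set_scope.
Local Open Scope ring_scope.
Local Open Scope complex_scope.
Local Open Scope sesquilinear_scope.

Definition psdmx (C : numClosedFieldType) (n : nat) (M : 'M[C]_n) : Prop :=
  M \is hermsymmx /\ forall v : 'rV[C]_n, 0 <= (v *m M *m v ^t*) 0 0.

Definition positive_definite (R : realType) (f : R -> R[i]) : Prop :=
  forall (n : nat) (x : 'I_n -> R), psdmx (\matrix_(i, j) f (x i - x j)).

Definition expi (R : realType) (t : R) : R[i] := cos t +i* sin t.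

(* Lebesgue integral over the real line of a complex-valued function, taken
   componentwise; as for Rintegral, it is meaningful only for integrable f. *)
Definition Cintegral (R : realType) (f : R -> R[i]) : R[i] :=
  (\int[lebesgue_measure]_x complex.Re (f x)) +i*
  (\int[lebesgue_measure]_x complex.Im (f x)).

Definition fourier (R : realType) (K : R -> R) (xi : R) : R[i] :=
  Cintegral (fun x => (K x)%:C * expi (xi * x)).

(* Positive definiteness is a pointwise notion, so a kernel is a function and
   not an almost-everywhere class. *)
Definition pd_kernel (R : realType) (K : R -> R) : Prop :=
  [/\ forall x, 0 <= K x,
      lebesgue_measure.-integrable setT (EFin \o K),
      positive_definite (fun x => (K x)%:C),
      forall x, K (- x) = K x
    & \int[lebesgue_measure]_x K x = 1].

(* The values lie in R[i], where z < 0 (resp. 0 < z) means that z is real and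
   negative (resp. positive). *)
Definition dispersion (R : realType) (w RL JF : R -> R) (A B C D xi : R)
    : R[i] :=
  A%:C * fourier w `|xi| + B%:C * fourier RL `|xi|
    + C%:C * fourier JF `|xi| + D%:C.

(* Main.v *)
(** The kernels are even, so [lambda] is real and equals [A w^ + B R^ + C J^ + D],
    where [A >= 0], [B <= 0] and [C > 0], while the equilibrium equation gives
    [D = - phi Gbar / Gbar < 0].  By the Riemann-Lebesgue lemma [lambda xi] tends
    to [D], which gives (1); for (2), [0 <= R^], [w^ <= 1] and [J^ <= 1] give
    [lambda xi <= A + C + D].

    The Riemann-Lebesgue lemma follows from the continuity of translations in
    L1, since a shift by half a period changes the sign of the cosine.

    A positive definite kernel [K] need not be continuous, so [0 <= K^ xi] cannot
    be read off Riemann sums.  Instead, [h x = K x * cos (xi * x)] satisfies, for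
    the points [0, t, ..., (n - 1) t],
      [0 <= h 0 + 2 * sum_(1 <= k < n) (1 - k / n) h (k t)]   for every [t],
    and this is averaged over [t] with the density [1 / |t|] on the annulus
    [1 <= M |t| < 2].  Substituting [u = k t] turns the sum into the integral of
    [h] against weights bounded by 1, which tend to [1 / 2] when [n = M ^ 2] and
    [M] tends to infinity, while the term [h 0] gets the factor [1 / M]. *)

Require Import Defs.
From HB Require Import structures.
From mathcomp Require Import all_boot all_order all_algebra.
From mathcomp Require Import complex.
From mathcomp Require Import all_classical all_reals all_analysis.
From mathcomp Require Import measurable_realfun ring lra.

Import Order.TTheory GRing.Theory Num.Theory.
Import numFieldNormedType.Exports.

Local Open Scope classical_set_scope.
Local Open Scope ring_scope.

(** * Affine substitution in Lebesgue integrals *)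

Section affine_change_of_variables.
Context {R : realType}.
Local Notation mu := (@lebesgue_measure R).
Implicit Types (c d : R).

(** Half-open intervals suffice because they determine Lebesgue measure. A negative [c] swaps the
    ends, so the preimage becomes closed on the left, hence the two cases. *)
Lemma lebesgue_measure_preimage_affine c d (a b : R) : c != 0 ->
  mu ((fun x : R => c * x + d) @^-1` `]a, b]) = (`|c|^-1%:E * mu `]a, b])%E.
Proof.
move=> c0; have [c_gt0|c_le0] := ltrP 0 c.
- have -> : (fun x : R => c * x + d) @^-1` `]a, b] =
            `](a - d) / c, (b - d) / c]%classic.
    by apply/seteqP; split => x /=;
      rewrite !in_itv/= ltr_pdivrMr// ler_pdivlMr//; lra.
  rewrite !lebesgue_measure_itv/= !lte_fin ltr_pM2r ?invr_gt0// ltrD2r.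
  case: ifPn => ab; last by rewrite mule0.
  by rewrite -!EFinD -EFinM; congr (_%:E); rewrite gtr0_norm//; field.
- have {c_le0}c_lt0 : c < 0 by rewrite lt_neqAle c0.
  have -> : (fun x : R => c * x + d) @^-1` `]a, b] =
            `[(b - d) / c, (a - d) / c[%classic.
    by apply/seteqP; split => x /=;
      rewrite !in_itv/= ltr_ndivlMr// ler_ndivrMr//; lra.
  rewrite !lebesgue_measure_itv/= !lte_fin ltr_nM2r ?invr_lt0// ltrD2r.
  case: ifPn => ab; last by rewrite mule0.
  by rewrite -!EFinD -EFinM; congr (_%:E); rewrite ltr0_norm//; field.
Qed.

Lemma measurable_affine c d : measurable_fun setT (fun x : R => c * x + d).
Proof. by apply: measurable_funD => //; exact: measurable_funM. Qed.

(** The pushforward of [mu] under the affine map, rescaled by the norm of [c], agrees with [mu] on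
    half-open intervals, hence is [mu]. *)
Lemma ge0_integral_affine c d (f : R -> \bar R) : c != 0 ->
  measurable_fun setT f -> (forall x, 0 <= f x)%E ->
  (\int[mu]_x f x = `|c|%:E * \int[mu]_x f (c * x + d)%R)%E.
Proof.
move=> c0 mf f0.
pose phi x : measurableTypeR R := c * (x : measurableTypeR R) + d.
have mphi : measurable_fun setT phi by exact: measurable_affine.
have -> : (\int[mu]_x f (c * x + d)%R = \int[pushforward mu phi]_x f x)%E.
  by rewrite ge0_integral_pushforward.
have nc0 : 0 <= `|c| by [].
rewrite -(ge0_integral_mscale _ measurableT (NngNum nc0))//.
apply: eq_measure_integral => A mA _.
apply: lebesgue_measure_unique => //.
move=> _ [[a b] _ <-] /=.
rewrite /mscale/= /pushforward lebesgue_measure_preimage_affine// muleA.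
by rewrite -EFinM divff ?normr_eq0// mul1e.
Qed.

Lemma integrable_affine c d (f : R -> R) : c != 0 ->
  mu.-integrable setT (EFin \o f) ->
  mu.-integrable setT (EFin \o (fun x => f (c * x + d))).
Proof.
move=> c0 /integrableP[mf foo]; apply/integrableP; split.
  exact: (measurableT_comp mf (measurable_affine c d)).
have -> : (\int[mu]_x `|(EFin \o (fun x => f (c * x + d)%R)) x| =
            `|c|^-1%:E * \int[mu]_x `|(EFin \o f) x|)%E.
  rewrite [in RHS](ge0_integral_affine c d)//; last exact: measurableT_comp.
  by rewrite muleA -EFinM mulVf ?normr_eq0// mul1e.
by rewrite lte_mul_pinfty// lee_fin invr_ge0.
Qed.

(** Reduces to the nonnegative case through the positive and negative parts of [f]. *)
Lemma Rintegral_affine c d (f : R -> R) : c != 0 ->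
  mu.-integrable setT (EFin \o f) ->
  \int[mu]_x f (c * x + d) = `|c|^-1 * \int[mu]_x f x.
Proof.
move=> c0 intf; have mf := measurable_int _ intf.
have int_fp := integrable_affine c d _ c0 (integrable_funrpos measurableT intf).
have int_fn := integrable_affine c d _ c0 (integrable_funrneg measurableT intf).
have split_int (g : R -> R) : mu.-integrable setT (EFin \o g) ->
    \int[mu]_x g x = \int[mu]_x g^\+ x - \int[mu]_x g^\- x.
  move=> ig; rewrite -RintegralB//; last 2 first.
  - exact: integrable_funrpos.
  - exact: integrable_funrneg.
  by apply: eq_Rintegral => x _; rewrite -[in LHS](funrposBneg g).
have ge0 (g : R -> R) : mu.-integrable setT (EFin \o g) -> (forall x, 0 <= g x) ->
    \int[mu]_x g (c * x + d) = `|c|^-1 * \int[mu]_x g x.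
  move=> ig g0; rewrite /Rintegral [X in _ = _ * fine X](ge0_integral_affine c d)//.
  - rewrite fineM//= ?mulKf ?normr_eq0//.
    exact: (integrable_fin_num measurableT (integrable_affine c d _ c0 ig)).
  - exact: measurable_int ig.
rewrite (split_int (fun x => f (c * x + d))); last exact: integrable_affine.
rewrite (split_int f)// mulrBr -!ge0//.
- exact: integrable_funrneg.
- exact: integrable_funrpos.
Qed.

Lemma Rintegral_odd (f : R -> R) : mu.-integrable setT (EFin \o f) ->
  (forall x, f (- x) = - f x) -> \int[mu]_x f x = 0.
Proof.
move=> intf fodd; have N10 : -1 != 0 :> R by rewrite oppr_eq0 oner_neq0.
have := Rintegral_affine (-1) 0 f N10 intf.
under eq_Rintegral do rewrite mulN1r addr0 fodd -mulN1r.
by rewrite RintegralZl// normrN1 invr1; lra.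
Qed.

End affine_change_of_variables.

(** * Dominated convergence for real-valued integrals *)

Section Rintegral_dominated_convergence.
Context d (T : measurableType d) (R : realType).
Variable mu : {measure set T -> \bar R}.

Lemma Rintegral_dominated_convergence (f_ : (T -> R)^nat) (f g : T -> R) :
  (forall n, measurable_fun setT (f_ n)) -> measurable_fun setT f ->
  {ae mu, forall x, f_ ^~ x @ \oo --> f x} ->
  mu.-integrable setT (EFin \o g) -> (forall n x, `|f_ n x| <= g x) ->
  \int[mu]_x f_ n x @[n --> \oo] --> \int[mu]_x f x.
Proof.
move=> mf_ mf f_f ig f_g.
have [||||intf _ cvgf] := @dominated_convergence _ _ _ mu _ measurableT
  (fun n => EFin \o f_ n) (EFin \o f) (EFin \o g) _ _ _ ig.
- by move=> n; exact/measurable_EFinP.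
- exact/measurable_EFinP.
- by apply: filterS f_f => x fx _; apply/fine_cvgP; split; [exact: nearW|].
- by apply: aeW => x n _ /=; rewrite lee_fin.
by apply: fine_cvg; rewrite fineK//; exact: integrable_fin_num.
Qed.

End Rintegral_dominated_convergence.

(** * The Riemann-Lebesgue lemma for the cosine *)

Section Riemann_Lebesgue.
Context {R : realType}.
Local Notation mu := (@lebesgue_measure R).
Implicit Types f g : R -> R.

Lemma integrable_cos f (k : R) : mu.-integrable setT (EFin \o f) ->
  mu.-integrable setT (EFin \o (fun x => f x * cos (k * x))).
Proof.
move=> intf; apply: (le_integrable measurableT _ _ intf).
  apply/measurable_EFinP; apply: measurable_funM.
    by apply/measurable_EFinP; exact: measurable_int intf.
  apply: continuous_measurable_fun => x.
  by apply: (continuous_comp (f := *%R k)); [exact: mulrl_continuous|exact: continuous_cos].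
move=> x _ /=; rewrite lee_fin normrM ler_piMr//; exact: cos_max.
Qed.

Lemma integrable_sin f (k : R) : mu.-integrable setT (EFin \o f) ->
  mu.-integrable setT (EFin \o (fun x => f x * sin (k * x))).
Proof.
move=> intf; apply: (le_integrable measurableT _ _ intf).
  apply/measurable_EFinP; apply: measurable_funM.
    by apply/measurable_EFinP; exact: measurable_int intf.
  apply: continuous_measurable_fun => x.
  by apply: (continuous_comp (f := *%R k)); [exact: mulrl_continuous|exact: continuous_sin].
move=> x _ /=; rewrite lee_fin normrM ler_piMr//; exact: sin_max.
Qed.

Lemma integrable_shift f (h : R) : mu.-integrable setT (EFin \o f) ->
  mu.-integrable setT (EFin \o (fun x => f (x + h))).
Proof.
move=> /(integrable_affine 1 h _ (oner_neq0 R)).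
by apply: eq_integrable => // x _ /=; rewrite mul1r.
Qed.

Lemma Rintegral_shift f (h : R) : mu.-integrable setT (EFin \o f) ->
  \int[mu]_x f (x + h) = \int[mu]_x f x.
Proof.
move=> /(Rintegral_affine 1 h _ (oner_neq0 R)).
rewrite normr1 invr1 mul1r => <-.
by apply: eq_Rintegral => x _; rewrite mul1r.
Qed.

(* Shifting by half a period changes the sign of [cos (k * x)]. *)
Lemma cos_integral_le_shift f (k : R) : mu.-integrable setT (EFin \o f) ->
  k != 0 ->
  `|\int[mu]_x (f x * cos (k * x))| <= \int[mu]_x `|f x - f (x + pi / k)|.
Proof.
move=> intf k0; set h := pi / k; set I := \int[mu]_x _.
have intfc := integrable_cos f k intf.
have intfh := integrable_shift f h intf.
have intfhc := integrable_cos _ k intfh.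
have IE : I = - \int[mu]_x (f (x + h) * cos (k * x)).
  rewrite /I -(Rintegral_shift _ h intfc) -mulN1r -RintegralZl//.
  apply: eq_Rintegral => x _.
  have -> : k * (x + h) = k * x + pi by rewrite /h; field.
  by rewrite cosDpi mulrN mulN1r.
have intd : mu.-integrable setT (EFin \o (fun x => f x - f (x + h))).
  exact: (integrableB measurableT intf intfh).
(* [I] is the average of its definition and of the expression in [IE]. *)
have -> : I = 2^-1 * \int[mu]_x ((f x - f (x + h)) * cos (k * x)).
  under eq_Rintegral do rewrite mulrBl.
  by rewrite RintegralB// -/I; lra.
have le_norm := le_normr_Rintegral measurableT (integrable_cos _ k intd).
rewrite normrM [`|2^-1|]ger0_norm ?invr_ge0// (le_trans (ler_wpM2l _ le_norm)) ?invr_ge0//.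
rewrite (@le_trans _ _ (2^-1 * \int[mu]_x `|f x - f (x + h)|))//.
  rewrite ler_wpM2l ?invr_ge0//; apply: le_Rintegral => //.
  - exact/integrable_norm/integrable_cos.
  - exact: integrable_norm.
  - by move=> x _; rewrite normrM ler_piMr// cos_max.
by rewrite ler_piMl//; [exact: Rintegral_ge0|lra].
Qed.

Lemma near_eq_continuous f g (x : R) : (\forall y \near x, f y = g y) ->
  {for x, continuous f} -> {for x, continuous g}.
Proof.
move=> E cf; apply: (cvg_trans (near_eq_cvg E)).
have fg : f x = g x := nbhs_singleton E.
by move: cf; rewrite /prop_for /continuous_at fg.
Qed.

Lemma continuous_restrict_itv f (M x : R) : continuous f ->
  `|x| != M -> {for x, continuous (f \_ `[- M, M])}.
Proof.
move=> cf xM; have [xltM|Mltx|xEM] := ltgtP `|x| M; last by rewrite xEM eqxx in xM.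
- apply: near_eq_continuous (cf x); near=> y.
  rewrite patchE mem_set//= in_itv/= -ler_norml ltW//.
  by near: y; apply: (cvgr_lt `|x|) => //; exact: norm_continuous.
- apply: (@near_eq_continuous (cst 0)); last exact: cvg_cst.
  near=> y; rewrite patchE memNset//= in_itv/= -ler_norml.
  apply/negP; rewrite -ltNge.
  by near: y; apply: (cvgr_gt `|x|) => //; exact: norm_continuous.
Unshelve. all: by end_near. Qed.

Lemma integrable_restrict_itv f (M : R) : continuous f ->
  mu.-integrable setT (EFin \o (f \_ `[- M, M])).
Proof.
move=> cf; rewrite -restrict_EFin; apply: (integrable_mkcond _ _).1 => //.
apply: continuous_compact_integrable; first exact: segment_compact.
exact: continuous_subspaceT.
Qed.

Lemma restrict_itv_bounded f (M : R) : continuous f ->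
  exists2 C, 0 <= C & forall x, `|(f \_ `[- M, M]) x| <= C.
Proof.
move=> cf; have /compact_bounded [C [Cr hC]] : compact (f @` `[- M, M]).
  apply: continuous_compact; last exact: segment_compact.
  exact: continuous_subspaceT.
(* Every number above [C] is a bound; this one is also nonnegative. *)
exists (`|C| + 1); first by rewrite addr_ge0.
move=> x; rewrite patchE; case: ifPn => [xM|_]; last by rewrite normr0 addr_ge0.
apply: hC; first by rewrite ltr_pwDr// ler_norm.
by exists x => //; exact/set_mem.
Qed.

(** Dominated convergence: the truncation is continuous off the two endpoints, and bounded with
    bounded support. *)
Lemma cvg_shift_L1_continuous f (M : R) (h : R^nat) : continuous f ->
  h @ \oo --> 0 ->
  \int[mu]_x `|(f \_ `[- M, M]) x - (f \_ `[- M, M]) (x + h n)| @[n --> \oo]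
    --> 0.
Proof.
move=> cf h0; set F := f \_ _.
have [C C0 FC] := restrict_itv_bounded f M cf.
have [B [_ /(_ (`|B| + 1)) hB]] : bounded_fun h.
  by apply: cvg_seq_bounded; apply/cvg_ex; exists 0.
have intF := integrable_restrict_itv f M cf.
set H := `|B| + 1; have {}hB n : `|h n| <= H.
  by apply: hB => //; rewrite ltr_pwDr// ler_norm.
have mF : measurable_fun setT F by apply/measurable_EFinP; exact: measurable_int intF.
(* The interval is widened by the bound [H] on the shifts, so that outside it both [x] and [x + h n]
   lie off the support of [F]. *)
pose g x := (2 * C) * \1_`[- M - H, M + H] x.
have -> : 0 = \int[mu]_x `|F x - F x|.
  by under eq_Rintegral do rewrite subrr normr0; rewrite /Rintegral integral0.
apply: (@Rintegral_dominated_convergence _ _ _ mu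
  (fun n x => `|F x - F (x + h n)|) (fun x => `|F x - F x|) g).
- move=> n; apply: measurableT_comp => //; apply: measurable_funB => //.
  by apply/measurable_EFinP; exact: measurable_int (integrable_shift _ (h n) intF).
- by apply: measurableT_comp => //; apply: measurable_funB.
(* The truncation may jump at these two points. *)
- exists [set M; - M]; split.
  + exact: measurableU.
  + exact/countable_lebesgue_measure0/finite_set_countable.
  + move=> x /= nx; apply: contrapT => xM; apply: nx.
    apply: cvg_norm; apply: cvgB; first exact: cvg_cst.
    have : {for x, continuous F}.
      apply: continuous_restrict_itv => //; apply/negP => /eqP xEM; apply: xM.
      move: xEM; have [x0|x0] := lerP 0 x.
        by rewrite ger0_norm// => <-; left.
      by rewrite ltr0_norm// => <-; right; rewrite opprK.
    have xh : x + h n @[n --> \oo] --> x.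
      by rewrite -[X in _ --> X]addr0; apply: cvgD; [exact: cvg_cst|exact: h0].
    by move=> Fx; apply: (cvg_comp (fun n => x + h n) F xh).
- have -> : EFin \o g = (fun x => (2 * C)%:E *
      (EFin \o \1_(`[(- M - H)%R, (M + H)%R]%classic)) x)%E.
    by apply/funext => x; rewrite /g /= EFinM.
  by apply: integrableZl => //; exact: integrable_indic_itv.
- move=> n x; rewrite normr_id /g indicE; have [xE|xE] := boolP (x \in _).
    rewrite mulr1 (le_trans (ler_normB _ _))//.
    by rewrite (le_trans (lerD (FC x) (FC (x + h n))))//; lra.
  rewrite mulr0; suff [-> ->] : F x = 0 /\ F (x + h n) = 0 by rewrite subrr normr0.
  have H0 : 0 <= H by rewrite addr_ge0.
  have := hB n; rewrite ler_norml => /andP[hn1 hn2].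
  move: xE; rewrite notin_setE/= in_itv/= => /negP; rewrite negb_and -!ltNge => xE.
  by rewrite /F !patchE !memNset//= in_itv/=; apply/negP; rewrite negb_and -!ltNge;
    case/orP: xE => xE; apply/orP; [left|right|left|right]; lra.
Qed.

(** Truncation to a large interval costs [e / 2]; there the measure is finite, and the density of
    continuous functions in L1 costs the other [e / 2]. *)
Lemma L1_approx_continuous f (e : R) : mu.-integrable setT (EFin \o f) ->
  0 < e -> exists M g, continuous g /\
    \int[mu]_x `|f x - (g \_ `[- M, M]) x| < e.
Proof.
move=> intf e0.
have mf : measurable_fun setT f by apply/measurable_EFinP; exact: measurable_int intf.
have mfE n : measurable_fun setT (f \_ `[- n%:R, n%:R]).
  apply/(measurable_restrictT _ _).1 => //; exact: measurable_funTS.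
have int_fE (M : R) : mu.-integrable setT (EFin \o (f \_ `[- M, M])).
  rewrite -restrict_EFin; apply: (integrable_mkcond _ _).1 => //.
  exact: integrableS intf.
(* At each point the truncations eventually equal [f], and the norm of [f] dominates the
   differences. *)
have tail : \int[mu]_x `|f x - (f \_ `[- n%:R, n%:R]) x| @[n --> \oo] --> 0.
  have -> : 0 = \int[mu]_x `|f x - f x|.
    by under eq_Rintegral do rewrite subrr normr0; rewrite /Rintegral integral0.
  apply: (@Rintegral_dominated_convergence _ _ _ mu
    (fun n x => `|f x - (f \_ `[- n%:R, n%:R]) x|) (fun x => `|f x - f x|)
    (fun x => `|f x|)).
  - by move=> n; apply: measurableT_comp => //; apply: measurable_funB => //; exact: mfE.
  - by apply: measurableT_comp => //; apply: measurable_funB.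
  - apply: aeW => x; apply: cvg_near_cst; near=> n.
    rewrite patchE mem_set//= in_itv/= -ler_norml.
    by near: n; exact: nbhs_infty_ger.
  - exact: integrable_norm.
  - move=> n x; rewrite normr_id patchE/=.
    by case: ifPn => _; rewrite ?subrr ?normr0// subr0.
have e20 : 0 < e / 2 by rewrite divr_gt0.
have [N _ /(_ N (leqnn N))] := cvgr_lt _ tail _ e20.
set M : R := N%:R => tailM.
have Efin : (mu `[(- M)%R, M]%classic < +oo)%E.
  by rewrite lebesgue_measure_itv/=; case: ifP => _; rewrite ?ltry// -EFinD ltry.
have intfE : mu.-integrable `[- M, M] (EFin \o f) by exact: integrableS intf.
have [g [cg intg gf]] := approximation_continuous_integrable (measurable_itv _) Efin intfE.
have {}gf : \int[mu]_(x in `[- M, M]) `|f x - g n x| @[n --> \oo] --> 0.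
  exact: fine_cvg gf.
have [m _ /(_ m (leqnn m)) gfm] := cvgr_lt _ gf _ e20.
exists M, (g m); split; first exact: cg.
have intgE := integrable_restrict_itv (g m) M (cg m).
have int1 : mu.-integrable setT (EFin \o (fun x => `|f x - (f \_ `[- M, M]) x|)).
  by apply: integrable_norm; exact: (integrableB measurableT intf (int_fE M)).
have int2 : mu.-integrable setT
    (EFin \o (fun x => `|(f \_ `[- M, M]) x - (g m \_ `[- M, M]) x|)).
  by apply: integrable_norm; exact: (integrableB measurableT (int_fE M) intgE).
apply: (@le_lt_trans _ _ (\int[mu]_x (`|f x - (f \_ `[- M, M]) x| +
    `|(f \_ `[- M, M]) x - (g m \_ `[- M, M]) x|))).
  apply: le_Rintegral => //.
  - by apply: integrable_norm; exact: (integrableB measurableT intf intgE).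
  - exact: (integrableD measurableT int1 int2).
  - by move=> x _; exact: ler_distD.
rewrite RintegralD//.
have -> : \int[mu]_x `|(f \_ `[- M, M]) x - (g m \_ `[- M, M]) x| =
    \int[mu]_(x in `[- M, M]) `|f x - g m x|.
  rewrite [RHS]Rintegral_mkcond; apply: eq_Rintegral => x _.
  by rewrite !patchE; case: ifP => // _; rewrite subrr normr0.
by rewrite [e]splitr ltrD.
Unshelve. all: by end_near. Qed.

(** The error of the approximation is bounded by its L1 norm uniformly in [k], and the truncated
    continuous function is handled by the shift [pi / k], which tends to 0. *)
Lemma Riemann_Lebesgue_cos f : mu.-integrable setT (EFin \o f) ->
  \int[mu]_x (f x * cos (k * x)) @[k --> +oo] --> 0.
Proof.
(* The limit is tested along sequences, the form in which the shift lemma is stated. *)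
move=> intf; apply/cvg_pinftyP => u uoo; apply/cvgrPdist_lt => e e0.
have e20 : 0 < e / 2 by rewrite divr_gt0.
have [M [g [cg fg]]] := L1_approx_continuous f _ intf e20.
have intg := integrable_restrict_itv g M cg.
have pu0 : pi / u n @[n --> \oo] --> (0 : R).
  rewrite -[X in _ --> X](mulr0 pi); apply: cvgMl_tmp; apply/gtr0_cvgV0 => //.
  by near=> n; near: n; move/cvgryPgt: uoo; exact.
have := cvg_shift_L1_continuous g M _ cg pu0.
move=> /cvgrPdist_lt/(_ _ e20) shift_small.
near=> n; rewrite sub0r normrN.
have un0 : u n != 0.
  by rewrite gt_eqF//; near: n; move/cvgryPgt: uoo; exact.
have intd : mu.-integrable setT (EFin \o (fun x => f x - (g \_ `[- M, M]) x)).
  exact: (integrableB measurableT intf intg).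
have -> : \int[mu]_x (f x * cos (u n * x)) =
    \int[mu]_x ((f x - (g \_ `[- M, M]) x) * cos (u n * x)) +
    \int[mu]_x ((g \_ `[- M, M]) x * cos (u n * x)).
  rewrite -RintegralD//; [|exact: integrable_cos|exact: integrable_cos].
  by apply: eq_Rintegral => x _; rewrite mulrBl subrK.
rewrite [e]splitr (le_lt_trans (ler_normD _ _))// ltrD//.
  apply: le_lt_trans fg.
  apply: (le_trans (le_normr_Rintegral measurableT (integrable_cos _ _ intd))).
  apply: le_Rintegral => //.
  - exact/integrable_norm/integrable_cos.
  - exact: integrable_norm.
  - by move=> x _; rewrite normrM ler_piMr// cos_max.
apply: (le_lt_trans (cos_integral_le_shift _ _ intg un0)).
have : `|0 - \int[mu]_x `|(g \_ `[- M, M]) x - (g \_ `[- M, M]) (x + pi / u n)| | < e / 2.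
  by near: n.
by rewrite sub0r normrN ger0_norm//; exact: Rintegral_ge0.
Unshelve. all: by end_near. Qed.

End Riemann_Lebesgue.

(** * Quadratic forms on a lattice and the averaged Fejer weights *)

Section lattice_kernel.
Context {R : realType}.
Local Notation mu := (@lebesgue_measure R).
Implicit Types (x y t u : R) (n k : nat).

(** Each difference [k] and its opposite come from [n - k] pairs, and evenness merges the two. The
    induction adds a last row, a last column and a diagonal term. *)
Lemma sum_lattice_differences (h : R -> R) t n : (forall x, h (- x) = h x) ->
  \sum_(i < n) \sum_(j < n) h (i%:R * t - j%:R * t) =
  n%:R * h 0 + 2 * \sum_(1 <= k < n) (n%:R - k%:R) * h (k%:R * t).
Proof.
move=> heven; elim: n => [|n IHn]; first by rewrite big_ord0 big_geq// mul0r mulr0 addr0.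
rewrite big_ord_recr/=.
under eq_bigr do rewrite big_ord_recr/=.
rewrite big_split/= {}IHn big_ord_recr/= subrr.
have E : \sum_(j < n) h (n%:R * t - j%:R * t) = \sum_(1 <= k < n.+1) h (k%:R * t).
  rewrite -(big_mkord xpredT (fun j => h (n%:R * t - j%:R * t))) big_nat_rev/= add0n.
  rewrite [RHS]big_add1/=; apply: eq_big_nat => j /andP[_ jn].
  by congr h; rewrite natrB//; ring.
have -> : \sum_(i < n) h (i%:R * t - n%:R * t) = \sum_(1 <= k < n.+1) h (k%:R * t).
  by rewrite -E; apply: eq_bigr => i _; rewrite -heven opprB.
rewrite E.
have -> : \sum_(1 <= k < n.+1) (n.+1%:R - k%:R) * h (k%:R * t) =
   \sum_(1 <= k < n) (n%:R - k%:R) * h (k%:R * t) + \sum_(1 <= k < n.+1) h (k%:R * t).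
  transitivity (\sum_(1 <= k < n.+1) ((n%:R - k%:R) * h (k%:R * t) + h (k%:R * t))).
    by apply: eq_bigr => k _; rewrite -natr1; ring.
  rewrite big_split/=; congr (_ + _).
  case: n {E} => [|n]; first by rewrite !big_nil.
  by rewrite big_nat_recr//= subrr mul0r addr0.
by rewrite -natr1; ring.
Qed.

(** For [0 < n] and [0 <= y] this is the integer part of [y] capped at [n - 1]. *)
Definition count_le n y : R := \sum_(1 <= k < n) (k%:R <= y)%R%:R.

(** Either the cap is reached or the count is the integer part of [y], described by inequalities
    only. *)
Lemma count_le_dichotomy n y : (0 < n)%N -> 0 <= y ->
  (count_le n y = n.-1%:R /\ n.-1%:R <= y) \/
  [/\ y - 1 < count_le n y, count_le n y <= y & y < n%:R].
Proof.
rewrite /count_le; case: n => // n _ y0.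
elim: n => [|n IHn]; first by left; rewrite big_geq.
rewrite big_nat_recr//=; have [ny|yn] := lerP n.+1%:R y.
  left; split => //; case: IHn => [[-> _]|[_ _ yn]]; first by rewrite natr1.
  by rewrite ltNge ny in yn.
right; rewrite addr0; case: IHn => [[-> ny]|[? ? _]]; split => //.
- by move: yn; rewrite -natr1/=; lra.
- by apply: lt_trans yn _; rewrite ltr_nat.
- by apply: lt_trans yn _; rewrite ltr_nat.
Qed.

Lemma count_le_upper n y : (0 < n)%N -> 0 <= y -> count_le n y <= y.
Proof. by move=> n0 /(count_le_dichotomy _ _ n0) [[->]|[]]. Qed.

Lemma count_le_lower n y : (0 < n)%N -> 0 <= y -> y < n%:R ->
  y - 1 < count_le n y.
Proof.
move=> n0 /(count_le_dichotomy _ _ n0) [[-> _] yn|[]//].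
by rewrite ltrBlDr; case: n n0 yn => //= n _; rewrite natr1.
Qed.

(** The indices counted on the left are the integers [k] with [y / 2 < k <= y]. *)
Lemma count_le_half n y : 0 <= y ->
  \sum_(1 <= k < n) (k%:R <= y < 2 * k%:R)%R%:R = count_le n y - count_le n (y / 2).
Proof.
move=> y0; rewrite /count_le -sumrB; apply: eq_bigr => k _.
have -> : (k%:R <= y / 2) = (2 * k%:R <= y) by rewrite ler_pdivlMr// mulrC.
have k0 : 0 <= k%:R :> R by [].
have [|] := lerP (2 * k%:R) y; have [|] := lerP k%:R y; rewrite /= ?subrr ?subr0//.
lra.
Qed.

(* The density [1 / `|x|] makes the contributions of the scales [k] to
   [Fejer_weight] equal, so that this weight is a count of integers. *)
Definition annulus_weight x : R := `|x|^-1 * (1 <= `|x| < 2)%R%:R.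

Lemma annulus_weight_scale k x : (0 < k)%N ->
  k%:R^-1 * annulus_weight (x / k%:R) = `|x|^-1 * (k%:R <= `|x| < 2 * k%:R)%R%:R.
Proof.
move=> k0; have kR0 : 0 < k%:R :> R by rewrite ltr0n.
rewrite /annulus_weight normrM normfV [`|k%:R|]ger0_norm//.
rewrite ler_pdivlMr// mul1r ltr_pdivrMr// invfM invrK mulrA.
by congr (_ * _); rewrite mulrCA mulVf ?mulr1// gt_eqF.
Qed.

(** The total weight after the substitution [u = k t] at every scale: a Fejer coefficient, the
    Jacobian [k^-1] and the rescaled density. *)
Definition Fejer_weight n x : R :=
  \sum_(1 <= k < n) (n%:R - k%:R) / n%:R * (k%:R^-1 * annulus_weight (x / k%:R)).

Lemma Fejer_weightE n x : Fejer_weight n x =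
  `|x|^-1 * \sum_(1 <= k < n) (n%:R - k%:R) / n%:R * (k%:R <= `|x| < 2 * k%:R)%R%:R.
Proof.
rewrite /Fejer_weight mulr_sumr; apply: eq_big_nat => k /andP[k0 _].
by rewrite annulus_weight_scale// mulrCA.
Qed.

Let Fejer_coef_ge0 n k : (k < n)%N -> 0 <= (n%:R - k%:R) / n%:R :> R.
Proof. by move=> kn; rewrite divr_ge0// subr_ge0 ler_nat ltnW. Qed.

Let Fejer_coef_le1 n k : (k < n)%N -> (n%:R - k%:R) / n%:R <= 1 :> R.
Proof.
move=> kn; rewrite ler_pdivrMr ?ltr0n ?(leq_ltn_trans _ kn)// mul1r.
by rewrite gerBl.
Qed.

Lemma Fejer_weight_ge0 n x : 0 <= Fejer_weight n x.
Proof.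
rewrite Fejer_weightE mulr_ge0 ?invr_ge0//.
rewrite big_nat_cond; apply: sumr_ge0 => k; rewrite andbT => /andP[_ kn].
by rewrite mulr_ge0// Fejer_coef_ge0.
Qed.

Let Fejer_sum_le n y : 0 <= y ->
  \sum_(1 <= k < n) (n%:R - k%:R) / n%:R * (k%:R <= y < 2 * k%:R)%R%:R <=
  \sum_(1 <= k < n) (k%:R <= y < 2 * k%:R)%R%:R :> R.
Proof.
move=> y0; apply: ler_sum_nat => k /andP[_ kn].
by rewrite ler_piMl// Fejer_coef_le1.
Qed.

(** With coefficients at most 1, the sum counts at most [|x|] integers, which the prefactor
    compensates. *)
Lemma Fejer_weight_le1 n x : (0 < n)%N -> Fejer_weight n x <= 1.
Proof.
move=> n0; rewrite Fejer_weightE; have [->|x0] := eqVneq x 0.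
  by rewrite normr0 invr0 mul0r.
have nx0 : 0 < `|x| by rewrite normr_gt0.
rewrite mulrC ler_pdivrMr// mul1r (le_trans (Fejer_sum_le _ _ _))//.
rewrite count_le_half//; have /= := count_le_upper n `|x| n0.
have : 0 <= count_le n (`|x| / 2) by apply: sumr_ge0.
by move=> ? /(_ (normr_ge0 _)); lra.
Qed.

(** About [|x| / 2] integers are counted, with coefficients between [1 - |x| / n] and 1. Rounding
    the count accounts for the first error term, the coefficients for the second. *)
Lemma Fejer_weight_near_half n x : (0 < n)%N -> x != 0 -> `|x| < n%:R ->
  `|Fejer_weight n x - 2^-1| <= `|x|^-1 + `|x| / n%:R.
Proof.
move=> n0 x0 xn; have nx0 : 0 < `|x| by rewrite normr_gt0.
have nR0 : 0 < n%:R :> R by rewrite ltr0n.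
rewrite Fejer_weightE; set y := `|x| in nx0 xn *.
set S := \sum_(1 <= k < n) _.
have y0 := ltW nx0.
have y20 : 0 <= y / 2 by rewrite divr_ge0.
have Cu := count_le_upper _ _ n0 y0; have Cl := count_le_lower _ _ n0 y0 xn.
have Cu2 := count_le_upper _ _ n0 y20.
have Cl2 : y / 2 - 1 < count_le n (y / 2) by apply: count_le_lower => //; lra.
have SC : S <= count_le n y - count_le n (y / 2).
  by rewrite -count_le_half//; exact: Fejer_sum_le.
(* Every counted [k] satisfies [k <= y], so its coefficient is at least [1 - y / n]. *)
have CS : (1 - y / n%:R) * (count_le n y - count_le n (y / 2)) <= S.
  rewrite -count_le_half// mulr_sumr; apply: ler_sum_nat => k /andP[_ kn].
  have [/andP[ky _]|_] := boolP (_ && _); last by rewrite !mulr0.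
  by rewrite !mulr1 mulrBl divff ?gt_eqF// lerD2l lerN2 ler_pM2r ?invr_gt0.
have yn1 : 0 <= 1 - y / n%:R by rewrite subr_ge0 ler_pdivrMr// mul1r ltW.
have {}CS : (1 - y / n%:R) * (y / 2 - 1) <= S.
  by apply: le_trans CS; apply: ler_wpM2l => //; lra.
have yV0 : 0 < y^-1 by rewrite invr_gt0.
have yVy : y^-1 * y = 1 by rewrite mulVf ?gt_eqF.
have S_le : y^-1 * S <= 2^-1 + y^-1.
  have -> : 2^-1 + y^-1 = y^-1 * (y / 2 + 1) by rewrite mulrDr mulrA yVy mul1r mulr1.
  by rewrite ler_pM2l//; lra.
have S_ge : (1 - y / n%:R) * (2^-1 - y^-1) <= y^-1 * S.
  have -> : (1 - y / n%:R) * (2^-1 - y^-1) = y^-1 * ((1 - y / n%:R) * (y / 2 - 1)).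
    by field; rewrite !gt_eqF.
  by rewrite ler_pM2l.
have q0 : 0 <= y / n%:R by rewrite divr_ge0.
have p0 : 0 <= y / n%:R * y^-1 by rewrite mulr_ge0// ltW.
set q := y / n%:R in S_ge q0 p0 yn1 *; rewrite ler_norml; apply/andP; split; nra.
Qed.

End lattice_kernel.

(** * Integrals of finite sums *)

Section Rintegral_sum.
Context d (T : measurableType d) (R : realType).
Variable mu : {measure set T -> \bar R}.

(** Integrability is asked only for indices in [s], because the substitution [u = k t] is available
    only for nonzero [k]. *)
Lemma integrable_Rsum (I : eqType) (s : seq I) (f : I -> T -> R) :
  (forall i, i \in s -> mu.-integrable setT (EFin \o f i)) ->
  mu.-integrable setT (EFin \o (fun x => \sum_(i <- s) f i x)).
Proof.
move=> intf; rewrite (_ : _ \o _ = fun x => (\sum_(i <- s | i \in s) (EFin \o f i) x)%E).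
  by apply: integrable_sum.
by apply/funext => x /=; rewrite sumEFin -big_seq.
Qed.

Lemma Rintegral_sum (I : eqType) (s : seq I) (f : I -> T -> R) :
  (forall i, i \in s -> mu.-integrable setT (EFin \o f i)) ->
  \int[mu]_x (\sum_(i <- s) f i x) = \sum_(i <- s) \int[mu]_x f i x.
Proof.
elim: s => [|i s IHs] intf.
  by under eq_Rintegral do rewrite big_nil; rewrite big_nil /Rintegral integral0.
have ints j : j \in s -> mu.-integrable setT (EFin \o f j).
  by move=> js; apply: intf; rewrite in_cons js orbT.
under eq_Rintegral do rewrite big_cons.
rewrite big_cons RintegralD ?IHs//; last exact: integrable_Rsum.
by apply: intf; rewrite mem_head.
Qed.

End Rintegral_sum.

(** * Nonnegative integral of an even function of positive type *)

Section positive_type.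
Context {R : realType}.
Local Notation mu := (@lebesgue_measure R).
Local Notation rho := (@annulus_weight R).

Lemma measurable_annulus_weight : measurable_fun setT rho.
Proof.
rewrite (_ : rho = fun x => if (1 <= `|x|) && (`|x| < 2) then `|x| `^ (-1) else 0).
  apply: measurable_fun_ifT => //.
    apply: measurable_and.
      by apply: measurable_fun_ler => //; exact: measurableT_comp.
    by apply: measurable_fun_ltr => //; exact: measurableT_comp.
  exact: (measurableT_comp (measurable_powR _)).
apply/funext => x; rewrite /annulus_weight powR_inv1//.
by case: ifPn => _; rewrite ?mulr1 ?mulr0.
Qed.

Lemma annulus_weight_norm_le1 (x : R) : `|rho x| <= 1.
Proof.
rewrite /annulus_weight; have [/andP[x1 _]|_] := boolP (_ && _).
  by rewrite mulr1 ger0_norm ?invr_ge0// invf_le1// (lt_le_trans _ x1).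
by rewrite mulr0 normr0.
Qed.

Lemma integrable_annulus_weight : mu.-integrable setT (EFin \o rho).
Proof.
apply: (le_integrable measurableT _ _ (integrable_indic_itv (-2) 2 true true)).
  by apply/measurable_EFinP; exact: measurable_annulus_weight.
move=> x _ /=; rewrite lee_fin indicE.
have [xin|xnin] := boolP (x \in _); first by rewrite normr1 annulus_weight_norm_le1.
rewrite /annulus_weight ltr_norml.
suff -> : (-2 < x < 2) = false by rewrite andbF mulr0.
by apply: contraNF xnin => /andP[x1 x2]; rewrite inE/= in_itv/= (ltW x1).
Qed.

Lemma measurable_annulus_weight_scale (c : R) :
  measurable_fun setT (fun x => rho (c * x)).
Proof.
apply: (measurableT_comp measurable_annulus_weight); exact: measurable_funM.
Qed.

Lemma integrable_annulus_weightM (c : R) (f : R -> R) :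
  mu.-integrable setT (EFin \o f) ->
  mu.-integrable setT (EFin \o (fun x => rho (c * x) * f x)).
Proof.
move=> intf; apply: (le_integrable measurableT _ _ intf).
  apply/measurable_EFinP; apply: measurable_funM.
    exact: measurable_annulus_weight_scale.
  by apply/measurable_EFinP; exact: measurable_int intf.
by move=> x _ /=; rewrite lee_fin normrM ler_piMl// annulus_weight_norm_le1.
Qed.

Lemma measurable_Fejer_weight (n : nat) (c : R) :
  measurable_fun setT (fun x => Fejer_weight n (c * x)).
Proof.
apply: measurable_sum => k; apply: measurable_funM => //.
apply: measurable_funM => //.
rewrite (_ : (fun x => _) = (fun x => rho (c / k%:R * x))).
  exact: measurable_annulus_weight_scale.
by apply/funext => x; rewrite mulrAC.
Qed.

Variable h : R -> R.
Hypothesis inth : mu.-integrable setT (EFin \o h).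
Hypothesis heven : forall x, h (- x) = h x.
Hypothesis hpos : forall n t,
  0 <= \sum_(i < n) \sum_(j < n) h (i%:R * t - j%:R * t).

Let Fejer_sum_ge0 (n : nat) (t : R) : (0 < n)%N ->
  0 <= h 0 + 2 * \sum_(1 <= k < n) (n%:R - k%:R) / n%:R * h (k%:R * t).
Proof.
move=> n0; have nR0 : 0 < n%:R :> R by rewrite ltr0n.
rewrite -(pmulr_rge0 _ nR0) mulrDr.
suff -> : n%:R * (2 * \sum_(1 <= k < n) (n%:R - k%:R) / n%:R * h (k%:R * t)) =
    2 * \sum_(1 <= k < n) (n%:R - k%:R) * h (k%:R * t).
  by rewrite -sum_lattice_differences.
rewrite mulrCA; congr (_ * _); rewrite mulr_sumr; apply: eq_bigr => k _.
by field; rewrite gt_eqF.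
Qed.

(** The lattice inequality holds at every [t], so its integral against [rho (M * t)] is nonnegative;
    each scale is then rewritten in the variable [u = k t]. *)
Lemma Fejer_integral_ge0 (n : nat) (M : R) : (0 < n)%N -> 0 < M ->
  0 <= h 0 * (M^-1 * \int[mu]_x rho x) +
       2 * \int[mu]_u (Fejer_weight n (M * u) * h u).
Proof.
move=> n0 M0; have M_neq0 : M != 0 by rewrite gt_eqF.
pose c k : R := (n%:R - k%:R) / n%:R.
have intrho : mu.-integrable setT (EFin \o (fun t => rho (M * t))).
  have := integrable_affine M 0 _ M_neq0 integrable_annulus_weight.
  by apply: eq_integrable => // x _ /=; rewrite addr0.
have Irho : M^-1 * \int[mu]_x rho x = \int[mu]_t rho (M * t).
  have := Rintegral_affine M 0 _ M_neq0 integrable_annulus_weight.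
  by rewrite gtr0_norm// => <-; apply: eq_Rintegral => x _; rewrite addr0.
pose g k u := rho (M / k%:R * u) * h u.
have intg k : mu.-integrable setT (EFin \o g k) by exact: integrable_annulus_weightM.
have kR (k : nat) : k \in index_iota 1 n -> 0 < k%:R :> R.
  by rewrite mem_index_iota ltr0n => /andP[].
have gk (k : nat) : k \in index_iota 1 n ->
    forall t, g k (k%:R * t + 0) = rho (M * t) * h (k%:R * t).
  move=> /kR k0 t; rewrite /g addr0; congr (rho _ * _).
  by rewrite mulrA divfK// gt_eqF.
have intgk (k : nat) : k \in index_iota 1 n ->
    mu.-integrable setT (EFin \o (fun t => rho (M * t) * h (k%:R * t))).
  move=> kn; have := integrable_affine k%:R 0 _ (lt0r_neq0 (kR _ kn)) (intg k).
  by apply: eq_integrable => // x _ /=; rewrite gk.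
have Igk (k : nat) : k \in index_iota 1 n ->
    \int[mu]_t (rho (M * t) * h (k%:R * t)) = \int[mu]_u (k%:R^-1 * g k u).
  move=> kn; rewrite RintegralZl//.
  have := Rintegral_affine k%:R 0 _ (lt0r_neq0 (kR _ kn)) (intg k).
  rewrite (gtr0_norm (kR _ kn)) => <-.
  by apply: eq_Rintegral => x _; rewrite gk.
have intZ (a : R) f : mu.-integrable setT (EFin \o f) ->
    mu.-integrable setT (EFin \o (fun x => a * f x)).
  by move=> intf; exact: (integrableZl measurableT a intf).
(* The substitution is undone scale by scale, to reach one integral in [t]. *)
have -> : \int[mu]_u (Fejer_weight n (M * u) * h u) =
    \sum_(1 <= k < n) c k * \int[mu]_t (rho (M * t) * h (k%:R * t)).
  transitivity (\int[mu]_u (\sum_(1 <= k < n) c k * (k%:R^-1 * g k u))).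
    apply: eq_Rintegral => u _; rewrite /Fejer_weight mulr_suml.
    by apply: eq_bigr => k _; rewrite /g -!mulrA [u * _]mulrC.
  rewrite Rintegral_sum; last by move=> k _; exact/intZ/intZ.
  by apply: eq_big_seq => k kn; rewrite RintegralZl ?Igk//; exact: intZ.
rewrite Irho -RintegralZl//.
have -> : \sum_(1 <= k < n) c k * \int[mu]_t (rho (M * t) * h (k%:R * t)) =
    \int[mu]_t (\sum_(1 <= k < n) c k * (rho (M * t) * h (k%:R * t))).
  rewrite Rintegral_sum; last by move=> k kn; exact/intZ/intgk.
  by apply: eq_big_seq => k kn; rewrite RintegralZl//; exact: intgk.
have ints : mu.-integrable setT
    (EFin \o (fun t => \sum_(1 <= k < n) c k * (rho (M * t) * h (k%:R * t)))).
  by apply: integrable_Rsum => k kn; exact/intZ/intgk.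
rewrite -RintegralZl// -RintegralD//; [|exact: intZ|exact: intZ].
apply: Rintegral_ge0 => t _.
rewrite (_ : _ + _ = rho (M * t) *
    (h 0 + 2 * \sum_(1 <= k < n) (n%:R - k%:R) / n%:R * h (k%:R * t))).
  by rewrite mulr_ge0// ?Fejer_sum_ge0// /annulus_weight mulr_ge0 ?invr_ge0.
rewrite mulrDr mulrC; congr (_ + _); rewrite mulrCA; congr (_ * _).
by rewrite mulr_sumr; apply: eq_bigr => k _; rewrite mulrCA.
Qed.

Lemma positive_type_integral_ge0 : 0 <= \int[mu]_x h x.
Proof.
(* With [M = m + 1] and [n = M ^ 2], both error terms at [M * u] are of order [1 / M]: their sum is
   [(|u|^-1 + |u|) / M]. *)
pose W (m : nat) u := Fejer_weight (m.+1 ^ 2) (m.+1%:R * u) * h u.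
have mh : measurable_fun setT h by apply/measurable_EFinP; exact: measurable_int inth.
have cvgW : \int[mu]_u W m u @[m --> \oo] --> \int[mu]_u (2^-1 * h u).
  apply: (@Rintegral_dominated_convergence _ _ _ mu W (fun u => 2^-1 * h u)
    (fun u => `|h u|)).
  - by move=> m; apply: measurable_funM => //; exact: measurable_Fejer_weight.
  - exact: measurable_funM.
  (* At [u = 0] the weight is 0 for every [m], not close to one half. *)
  - exists [set 0]; split; [by []|exact: lebesgue_measure_set1|].
    move=> u /= nu; apply: contrapT => /eqP u0; apply: nu.
    apply: cvgM; last exact: cvg_cst.
    apply/cvgrPdist_le => e e0.
    near=> m; rewrite distrC.
    have nu0 : 0 < `|u| by rewrite normr_gt0.
    have m0 : 0 < m.+1%:R :> R by rewrite ltr0n.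
    (* This is the condition [|M u| < n] after division by [M]. *)
    have num : `|u| < m.+1%:R.
      apply: lt_trans (_ : m%:R < _); last by rewrite ltr_nat.
      by near: m; exact: nbhs_infty_gtr.
    apply: le_trans (Fejer_weight_near_half _ _ _ _ _) _.
    + by rewrite expn_gt0.
    + by rewrite mulf_neq0// gt_eqF.
    + by rewrite normrM gtr0_norm// natrX expr2 ltr_pM2l.
    have me : (`|u|^-1 + `|u|) / e < m.+1%:R.
      apply: lt_trans (_ : m%:R < _); last by rewrite ltr_nat.
      by near: m; exact: nbhs_infty_gtr.
    rewrite normrM gtr0_norm// natrX.
    rewrite (_ : _ + _ = (`|u|^-1 + `|u|) / m.+1%:R); last first.
      by field; rewrite !gt_eqF.
    by rewrite ler_pdivrMr// mulrC -ler_pdivrMr// ltW.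
  - exact: integrable_norm.
  - move=> m u; rewrite normrM ler_piMl// ger0_norm ?Fejer_weight_ge0//.
    by rewrite Fejer_weight_le1// expn_gt0.
have cvg0 : h 0 * (m.+1%:R^-1 * \int[mu]_x rho x) @[m --> \oo] --> (0 : R).
  rewrite -[X in _ --> X](mulr0 (h 0)); apply: cvgMl_tmp.
  rewrite -[X in _ --> X](mul0r (\int[mu]_x rho x)); apply: cvgMr_tmp.
  exact: cvg_harmonic.
have cvgs : h 0 * (m.+1%:R^-1 * \int[mu]_x rho x) + 2 * \int[mu]_u W m u
    @[m --> \oo] --> 0 + 2 * \int[mu]_u (2^-1 * h u).
  by apply: cvgD cvg0 _; exact: cvgMl_tmp.
have : 0 <= 0 + 2 * \int[mu]_u (2^-1 * h u).
  rewrite -(cvg_lim (@Rhausdorff R) cvgs); apply: limr_ge.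
    by apply/cvg_ex; eexists; exact: cvgs.
  by apply: nearW => m; apply: Fejer_integral_ge0; rewrite ?expn_gt0.
by rewrite add0r RintegralZl// mulVKf.
Unshelve. all: by end_near. Qed.

End positive_type.

(** * Fourier transforms of positive definite kernels *)

Section cosine_transform.
Context {R : realType}.
Local Notation mu := (@lebesgue_measure R).
Local Open Scope complex_scope.
Implicit Type K : R -> R.

Definition cosine_transform K (xi : R) : R := \int[mu]_x (K x * cos (xi * x)).

(** The imaginary part is the integral of an odd function. *)
Lemma fourier_even K xi : mu.-integrable setT (EFin \o K) ->
  (forall x, K (- x) = K x) -> fourier K xi = (cosine_transform K xi)%:C.
Proof.
move=> intK Keven; rewrite /fourier /Cintegral; congr (_ +i* _).
  by apply: eq_Rintegral => x _ /=; rewrite mul0r subr0.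
rewrite -[RHS](Rintegral_odd (fun x => K x * sin (xi * x))).
- by apply: eq_Rintegral => x _ /=; rewrite mul0r addr0.
- exact: integrable_sin.
- by move=> x; rewrite Keven mulrN sinN mulrN.
Qed.

Lemma positive_definite_real K n (x a : 'I_n -> R) :
  positive_definite (fun y => (K y)%:C) ->
  0 <= \sum_(i < n) \sum_(j < n) a i * a j * K (x i - x j).
Proof.
move=> /(_ n x) [_ /(_ (\row_i (a i)%:C))].
set q := fun_of_matrix _ 0 0; suff -> : q =
    (\sum_(i < n) \sum_(j < n) a i * a j * K (x i - x j))%:C.
  by rewrite ler0c.
(* The matrix product has the column index in its outer sum. *)
rewrite /q mxE exchange_big/= rmorph_sum/=; apply: eq_bigr => j _.
rewrite !mxE mulr_suml rmorph_sum/=; apply: eq_bigr => i _.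
rewrite !mxE.
rewrite [X in _ * X](conjc_real (a j)) -!rmorphM; congr (_%:C); exact: mulrAC.
Qed.

(* The cosine addition formula splits the quadratic form of [K * cos] into the
   quadratic forms of [K] at the real vectors [cos (xi * x)] and [sin (xi * x)]. *)
Lemma cosine_transform_ge0 K xi : mu.-integrable setT (EFin \o K) ->
  (forall x, K (- x) = K x) -> positive_definite (fun y => (K y)%:C) ->
  0 <= cosine_transform K xi.
Proof.
move=> intK Keven Kpd; apply: positive_type_integral_ge0.
- exact: integrable_cos.
- by move=> x; rewrite Keven mulrN cosN.
- move=> n t; pose x (i : 'I_n) : R := i%:R * t.
  have -> : \sum_(i < n) \sum_(j < n)
      K (i%:R * t - j%:R * t) * cos (xi * (i%:R * t - j%:R * t)) =
    \sum_(i < n) \sum_(j < n) cos (xi * x i) * cos (xi * x j) * K (x i - x j) +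
    \sum_(i < n) \sum_(j < n) sin (xi * x i) * sin (xi * x j) * K (x i - x j).
    rewrite -big_split; apply: eq_bigr => i _; rewrite -big_split.
    apply: eq_bigr => j _ /=; rewrite -mulrDl mulrC mulrBr cosB.
    by congr (_ * _).
  by apply: addr_ge0; apply: positive_definite_real.
Qed.

Lemma cosine_transform_le_integral K xi : mu.-integrable setT (EFin \o K) ->
  (forall x, 0 <= K x) -> cosine_transform K xi <= \int[mu]_x K x.
Proof.
move=> intK K0; apply: le_Rintegral => //; first exact: integrable_cos.
by move=> x _; rewrite ler_piMr// cos_le1.
Qed.

Lemma pd_kernel_fourier K xi : pd_kernel K ->
  fourier K xi = (cosine_transform K xi)%:C.
Proof. by move=> [_ intK _ Keven _]; exact: fourier_even. Qed.

Lemma pd_kernel_cosine_itv K xi : pd_kernel K -> 0 <= cosine_transform K xi <= 1.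
Proof.
move=> [K0 intK Kpd Keven K1]; rewrite cosine_transform_ge0//=.
by rewrite -K1 cosine_transform_le_integral.
Qed.

Lemma pd_kernel_cosine_cvg0 K : pd_kernel K ->
  cosine_transform K k @[k --> +oo] --> (0 : R).
Proof. by move=> [_ intK _ _ _]; exact: Riemann_Lebesgue_cos. Qed.

End cosine_transform.

(** * Sign of the derivative of a monotone function *)

Lemma nondecreasing_itv_derive1_ge0 (R : realType) (f : R -> R) (a b x : R) :
  (forall y z, a <= y <= b -> a <= z <= b -> y <= z -> f y <= f z) ->
  a < x -> x < b -> derivable f x 1 -> 0 <= derive1 f x.
Proof.
move=> fnd ax xb fx; rewrite /derive1.
pose q h : R := h^-1 * (f (h + x) - f x).
apply: (@limr_ge _ _ _ _ 0 q).
  rewrite (_ : q = fun h => h^-1 *: ((f \o shift x) (h *: 1) - f x)) //.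
  by apply/funext => h /=; rewrite /q [h *: 1]mulr1.
near=> h; rewrite /q.
have h0 : h != 0 by near: h; exact: nbhs_dnbhs_neq.
(* Monotonicity is known only between [a] and [b], so [h + x] must stay there. *)
have hx : `|h| < Num.min (x - a) (b - x).
  near: h; apply: dnbhs0_lt; by rewrite lt_min !subr_gt0 ax.
move: hx; rewrite lt_min !ltr_norml => /andP[/andP[h1 h2] /andP[h3 h4]].
have [h_gt0|h_lt0|hE] := ltgtP 0 h; last by rewrite hE eqxx in h0.
- apply: mulr_ge0; first by rewrite invr_ge0 ltW.
  by rewrite subr_ge0; apply: fnd; lra.
- apply: mulr_le0; first by rewrite invr_le0 ltW.
  by rewrite subr_le0; apply: fnd; lra.
Unshelve. all: by end_near. Qed.

(** * Signs of the coefficients and the dispersion relation *)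

Theorem mainTheorem3 (R : realType) (alpha r : R) (phi w JF RL : R -> R)
    (Gbar : R)
    (alpha_gt0 : 0 < alpha)
    (r_gt0 : 0 < r) (r_le1 : r <= 1)
    (phi_gt0 : forall x : R, 0 <= x <= 1 -> 0 < phi x)
    (phi_nondecreasing : forall x y : R,
      0 <= x <= 1 -> 0 <= y <= 1 -> x <= y -> phi x <= phi y)
    (w_kernel : pd_kernel w) (JF_kernel : pd_kernel JF)
    (RL_kernel : pd_kernel RL)
    (Gbar_gt0 : 0 < Gbar) (Gbar_lt1 : Gbar < 1)
    (phi_derivable : derivable phi Gbar 1)
    (Gbar_equilibrium :
      phi Gbar - alpha * Gbar * (1 - (1 - Gbar) / r) = 0) :
  let A := derive1 phi Gbar * (1 - Gbar) in
  let B := - (alpha / r) * Gbar * (1 - Gbar) in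
  let C := alpha * Gbar * (1 - (1 - Gbar) / r) in
  let D := - alpha * (1 - Gbar) * (1 - (1 - Gbar) / r) - phi Gbar in
  let lambda := dispersion w RL JF A B C D in
  lambda 0 < 0 ->
  (exists M : R, forall xi : R, M < `|xi| -> lambda xi < 0) /\
  ((exists xi : R, xi != 0 /\ 0 < lambda xi) -> 0 < A + C + D).
Proof.
move=> A B C D lambda _.
set q := 1 - (1 - Gbar) / r in Gbar_equilibrium C D lambda *.
have phi_gt : 0 < phi Gbar by apply: phi_gt0; rewrite !ltW.
have aG : 0 < alpha * Gbar by rewrite mulr_gt0.
(* The equilibrium equation says that [C] equals [phi Gbar]; this forces [q] to be positive, which
   the range of [r] alone does not. *)
have C_gt0 : 0 < C by rewrite /C; lra.
have q_gt0 : 0 < q by move: C_gt0; rewrite /C pmulr_rgt0.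
have D_lt0 : D < 0.
  have : 0 < alpha * (1 - Gbar) * q by rewrite !mulr_gt0// subr_gt0.
  by rewrite /D !mulNr; lra.
have A_ge0 : 0 <= A.
  rewrite mulr_ge0 ?subr_ge0 ?(ltW Gbar_lt1)//.
  exact: (nondecreasing_itv_derive1_ge0 _ _ 0 1).
have B_le0 : B <= 0.
  by rewrite /B !mulNr oppr_le0 !mulr_ge0 ?invr_ge0 ?subr_ge0// ltW.
pose L (xi : R) := A * cosine_transform w `|xi| + B * cosine_transform RL `|xi|
  + C * cosine_transform JF `|xi| + D.
have lambdaE (xi : R) : lambda xi = real_complex R (L xi).
  by rewrite /lambda /dispersion !pd_kernel_fourier// /L !rmorphD !rmorphM.
split; last first.
  move=> [xi [_]]; rewrite lambdaE ltcR /L.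
  have /andP[_ w1] := pd_kernel_cosine_itv w `|xi| w_kernel.
  have /andP[R0 _] := pd_kernel_cosine_itv RL `|xi| RL_kernel.
  have /andP[_ J1] := pd_kernel_cosine_itv JF `|xi| JF_kernel.
  have := ler_wpM2l A_ge0 w1; have := ler_wpM2l (ltW C_gt0) J1.
  have := mulr_le0_ge0 B_le0 R0; lra.
have cvgL : A * cosine_transform w k + B * cosine_transform RL k
    + C * cosine_transform JF k + D @[k --> +oo] --> A * 0 + B * 0 + C * 0 + D.
  apply: cvgD; last exact: cvg_cst.
  by apply: cvgD; [apply: cvgD|]; apply: cvgMl_tmp; exact: pd_kernel_cosine_cvg0.
rewrite !mulr0 !add0r in cvgL.
(* The limit [D] is negative, so the expression is negative beyond some [M]; it is applied at the
   norm of [xi], which covers both signs. *)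
have [M [_ LM]] := cvgr_lt _ cvgL 0 D_lt0.
by exists M => xi /LM Lxi; rewrite lambdaE ltcR.
Qed.
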